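(* Let $n\ge 3$ be an integer, let $\mathcal{D}_{2n}$ be the dihedral group of order $2n$, and let $\omega=\omega(\mathcal{P}(\mathcal{D}_{2n}))$ be the clique number of its power graph $\mathcal{P}(\mathcal{D}_{2n})$. Then the second largest eigenvalue of $\mathcal{P}(\mathcal{D}_{2n})$ satisfies $\lambda_{2}(\mathcal{P}(\mathcal{D}_{2n}))\ge \mu_{2}$, where $\mu_2$ is the second largest root of the equation $$\mu^{3}-(\omega-2)\mu^{2}-(n+\omega-1)\mu+(\omega-2)n=0.$$
   Context: The power graph $\mathcal{P}(\mathbb{G})$ of a finite group $\mathbb{G}$ is the simple undirected graph with vertex set $\mathbb{G}$ in which two distinct elements $x,y$ are adjacent if and only if one of them is an integral power of the other. The dihedral group is $\mathcal{D}_{2n}=\langle a,b \mid a^n=e,\ b^2=e,\ ba=a^{-1}b\rangle$, of order $2n$. The clique number $\omega(G)$ of a graph $G$ is the order of a largest complete subgraph of $G$. The eigenvalues of a graph $G$ on $N$ vertices are those of its adjacency matrix, listed with multiplicity as $\lambda_1(G)\ge\lambda_2(G)\ge\cdots\ge\lambda_N(G)$; $\lambda_2(G)$ is the second largest eigenvalue. Roots of the cubic are likewise ordered with multiplicity. *)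

(* Defs.v *)
From HB Require Import structures.
From mathcomp Require Import all_boot all_order all_fingroup all_algebra all_solvable.
From mathcomp Require Import polyrcf.
From mathcomp Require Import reals.

Set Implicit Arguments.
Unset Strict Implicit.
Unset Printing Implicit Defensive.

Import Order.TTheory GRing.Theory Num.Theory.

Local Open Scope ring_scope.

(* Simple graphs are given by a boolean adjacency relation on a finite type. *)

Definition clique (T : finType) (e : rel T) (S : {set T}) : bool :=
  [forall x in S, forall y in S, (x != y) ==> e x y].

Definition clique_number (T : finType) (e : rel T) : nat :=
  \max_(S : {set T} | clique e S) #|S|.

(* <[y]> consists of the integral powers of y, see integral_powerP. *)
Definition power_graph (gT : finGroupType) : rel gT :=
  [rel x y | (x != y) && ((x \in <[y]>%g) || (y \in <[x]>%g))].
Arguments power_graph : clear implicits.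

Lemma integral_powerP (gT : finGroupType) (x y : gT) :
  reflect (exists k : nat, (x = y ^+ k)%g \/ (x = y ^- k)%g) (x \in <[y]>%g).
Proof.
apply: (iffP (cycleP y x)) => [[k ->]|[k [->|->]]]; first by exists k; left.
  by exists k.
by apply/cycleP; rewrite groupV mem_cycle.
Qed.

Definition adjacency_matrix (R : realType) (T : finType) (e : rel T) :
    'M[R]_#|T| :=
  \matrix_(i, j) (e (enum_val i) (enum_val j))%:R.

(* The real roots of p, repeated according to multiplicity, in decreasing
   order.  rootsR p is the increasing list of distinct real roots of p. *)
Definition roots_decr (R : realType) (p : {poly R}) : seq R :=
  flatten [seq nseq (mup x p) x | x <- rev (rootsR p)].

Lemma roots_decrE (R : realType) (s : seq R) :
  sorted >=%R s -> roots_decr (\prod_(x <- s) ('X - x%:P)) = s.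
Proof.
move=> s_sorted; set p := \prod_(x <- s) _.
have p_neq0 : p != 0 by rewrite monic_neq0 // monic_prod_XsubC.
have mem_rootsR x : (x \in rootsR p) = (x \in s).
  by have := roots_on_rootsR p_neq0 x; rewrite in_itv /= root_prod_XsubC => <-.
have sorted_rootsR : sorted <%R (rootsR p) by exact: sorted_roots.
have uniq_rootsR : uniq (rootsR p) by exact: lt_sorted_uniq.
apply: (@sorted_eq _ >=%R) => //.
- by move=> y x z /= yx zy; apply: le_trans yx.
- by move=> x y /=; rewrite andbC => /le_anti.
- rewrite /roots_decr; have : sorted >%R (rev (rootsR p)).
    by rewrite rev_sorted.
  elim: (rev _) => //= x r IHr.
  rewrite path_sortedE; last by move=> y u v /= yu vy; apply: lt_trans yu.
  case/andP=> /allP x_gt /IHr r_sorted.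
  rewrite sorted_pairwise ?pairwise_cat -?sorted_pairwise ?r_sorted ?andbT;
    try by move=> y u v /= yu vy; apply: le_trans yu.
  apply/andP; split; last first.
    by elim: (mup x p) => //= k; case: k => //= k ->; rewrite lexx.
  apply/allrelP => u v /nseqP [-> _] /flattenP [_ /mapP [y ry ->]].
  by case/nseqP=> -> _; apply/ltW/x_gt.
apply/allP => x _ /=; apply/eqP; rewrite -[RHS](mu_prod_XsubC) -/p.
rewrite /roots_decr count_flatten -map_comp sumnE big_map.
rewrite (perm_big (rootsR p)) /=; last by rewrite perm_rev.
under eq_bigr => y _ do rewrite count_nseq /=.
case: (boolP (x \in rootsR p)) => [rx | rx].
  rewrite (bigD1_seq x) //= eqxx mul1n big1 ?addn0 // => y.
  by move/negPf=> ->; rewrite mul0n.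
rewrite mupNroot ?root_prod_XsubC -?mem_rootsR // big_seq big1 // => y ry.
by case: eqP rx => // <-; rewrite ry.
Qed.

(* For 1 <= k <= #|T|, the k-th largest adjacency eigenvalue, counted with
   multiplicity (all of them are real, the adjacency matrix being symmetric). *)
Definition graph_eigenvalue (R : realType) (T : finType) (e : rel T) (k : nat) :
    R :=
  (roots_decr (char_poly (adjacency_matrix R e)))`_k.-1.

(* Main.v *)
Require Import Defs.
From HB Require Import structures.
From mathcomp Require Import all_boot all_order all_fingroup all_algebra all_solvable.
From mathcomp Require Import reals.
From mathcomp Require Import polyrcf complex ring lra.

Import Order.TTheory GRing.Theory Num.Theory.
Local Open Scope ring_scope.

(** A pineapple is a clique [C] together with a set [L] of pendant vertices, all
    attached to the same vertex [v] of [C].  The power graph of the dihedral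
    group contains one with #|C| = w, the clique number, and #|L| = n: take for
    [C] a largest clique, for [v] the identity and for [L] the reflections.
    Indeed a reflection [l] is an involution that is a power of no element but
    itself, so its only neighbour is the identity; hence a clique with a
    reflection has at most two elements, whereas a rotation of order n > 2 forms
    a triangle with its inverse and the identity, and so the largest cliques
    consist of rotations.

    The vectors that are constant on [v], on C minus [v] and on [L] span a space
    which the adjacency matrix of the pineapple preserves, and the
    characteristic polynomial of the restriction is the cubic

        p(mu) = mu^3 - (w - 2) mu^2 - (n + w - 1) mu + (w - 2) n.

    So mu_2 is an eigenvalue of the pineapple, and by interlacing the power
    graph has two eigenvalues that are at least mu_2.  Interlacing is obtained
    here from the variational characterization of eigenvalues
    ([courant_fischer_ge]): it is enough to find a plane of vectors f on which
    f A f^T >= mu_2 f f^T, and vectors that vanish off the pineapple only see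
    the adjacency matrix of the pineapple.  The plane is spanned by the
    eigenvector u for mu_2, with values

        mu (mu - w + 2) on v,   mu on C minus v,   mu - w + 2 on L   (mu = mu_2),

    and by the indicator z of C minus [v], at which the form of A - mu_2 has the
    value (w - 1) (w - 2 - mu_2).  That this is nonnegative, and that u and z are
    independent, comes from the position of the roots of p: since p(0) > 0 and
    p(w - 2) < 0, the second largest root lies strictly between 0 and w - 2
    ([pineapple_cubic_second_root]). *)

(** * Lower bounds for the eigenvalues of real symmetric matrices *)

Local Notation toC := (map_mx (real_complex _)).

Section RealSymmetric.
Local Open Scope sesquilinear_scope.

Lemma char_poly_conj (F : comUnitRingType) N (P D : 'M[F]_N) :
  P \in unitmx -> char_poly (invmx P *m D *m P) = char_poly D.
Proof.
move=> Pu; have PVP : map_mx polyC (invmx P) *m map_mx polyC P = 1%:M.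
  by rewrite -map_mxM mulVmx // map_mx1.
rewrite /char_poly; have -> : char_poly_mx (invmx P *m D *m P)
    = map_mx polyC (invmx P) *m char_poly_mx D *m map_mx polyC P.
  rewrite /char_poly_mx mulmxBr mulmxBl !map_mxM; congr (_ - _).
  by rewrite scalar_mxC -mulmxA PVP mulmx1.
by rewrite !det_mulmx mulrAC -det_mulmx PVP det1 mul1r.
Qed.

(** The spectral theorem is used over the complex numbers, with real eigenvalues
    [d] but a unitary, possibly non-real, [P].  A complex row vector is therefore
    split below into its real and imaginary parts. *)
Lemma symmetric_diagonalization (R : rcfType) N (A : 'M[R]_N) : A^T = A ->
  exists d : 'rV[R]_N, exists2 P : 'M[R[i]]_N,
    P \is unitarymx & toC A = invmx P *m diag_mx (toC d) *m P.
Proof.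
move=> Asym.
have AH : toC A \is hermsymmx.
  apply/is_hermitianmxP; rewrite expr0 scale1r map_trmx Asym.
  by apply/matrixP=> i j; rewrite !mxE; exact: esym (conjc_real _).
have := hermitian_normalmx AH => /orthomx_spectralP AE.
exists (map_mx (@complex.Re R) (spectral_diag (toC A))), (spectralmx (toC A)).
  exact: spectral_unitarymx.
rewrite {1}AE; congr (_ *m diag_mx _ *m _); apply/rowP => i; rewrite !mxE.
have /mxOverP/(_ 0 i)/RRe_real := hermitian_spectral_diag_real AH.
by [].
Qed.

(** The mixed terms of x A x^* are purely imaginary, whether or not [A] is
    symmetric. *)
Lemma Re_sesqui (R : rcfType) N (A : 'M[R]_N) (x : 'rV[R[i]]_N)
    (a := map_mx (@complex.Re R) x) (b := map_mx (@complex.Im R) x) :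
  complex.Re ((x *m toC A *m x^t*) 0 0) =
  (a *m A *m a^T) 0 0 + (b *m A *m b^T) 0 0.
Proof.
rewrite ![(_ *m _ *m _) 0 0]mxE raddf_sum -big_split /=; apply: eq_bigr => j _.
rewrite ![in LHS]mxE ![in RHS]mxE !mulr_suml raddf_sum -big_split /=.
apply: eq_bigr => i _; rewrite !mxE.
by case: (x 0 i) (x 0 j) => [xr xi] [yr yi] /=; ring.
Qed.

Lemma Re_sesqui_diag (R : rcfType) N (d : 'rV[R]_N) (y : 'rV[R[i]]_N) :
  complex.Re ((y *m diag_mx (toC d) *m y^t*) 0 0) =
  \sum_i d 0 i * (complex.Re (y 0 i) ^+ 2 + complex.Im (y 0 i) ^+ 2).
Proof.
rewrite -map_diag_mx Re_sesqui !mul_mx_diag ![(_ *m _) 0 0]mxE -big_split /=.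
by apply: eq_bigr => i _; rewrite !mxE; ring.
Qed.

Lemma map_Re_mulmx (R : rcfType) k N (c : 'rV[R[i]]_k) (U : 'M[R]_(k, N)) :
  map_mx (@complex.Re R) (c *m toC U) = map_mx (@complex.Re R) c *m U.
Proof.
apply/rowP=> j; rewrite !mxE raddf_sum; apply: eq_bigr => i _.
by rewrite !mxE; case: (c 0 i) => u v /=; rewrite mulr0 subr0.
Qed.

Lemma map_Im_mulmx (R : rcfType) k N (c : 'rV[R[i]]_k) (U : 'M[R]_(k, N)) :
  map_mx (@complex.Im R) (c *m toC U) = map_mx (@complex.Im R) c *m U.
Proof.
apply/rowP=> j; rewrite !mxE raddf_sum; apply: eq_bigr => i _.
by rewrite !mxE; case: (c 0 i) => u v /=; rewrite mulr0 add0r.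
Qed.

(** The easy half of the Courant-Fischer theorem.  If at most [k] eigenvalues
    were at least [m], the k + 1 dimensional row space of [U] would contain,
    over the complex numbers, a nonzero vector orthogonal to all their
    eigenvectors.  On this vector the form of [A] is less than [m] times the
    squared norm, hence the same holds for its real or its imaginary part,
    which are both real combinations of the rows of [U]. *)
Lemma courant_fischer_ge (R : realType) N (A : 'M[R]_N) k (U : 'M[R]_(k.+1, N))
    (m : R) : A^T = A -> row_free U ->
  (forall c : 'rV_k.+1, m * (c *m U *m (c *m U)^T) 0 0
                      <= (c *m U *m A *m (c *m U)^T) 0 0) ->
  m <= (roots_decr (char_poly A))`_k.
Proof.
move=> Asym Ufree formU.
have [d [P Punitary AE]] := symmetric_diagonalization _ _ _ Asym.
have Punit := unitarymx_unit Punitary.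
pose s := sort >=%R [seq d 0 i | i <- enum 'I_N].
have ge_total : total (>=%R : rel R) by move=> x y; exact: le_total.
have s_sorted : sorted >=%R s by exact: sort_sorted.
have charE : char_poly A = \prod_(x <- s) ('X - x%:P).
  apply: (@map_poly_inj _ _ (real_complex R)).
  rewrite map_char_poly AE char_poly_conj // char_poly_trig ?diag_mx_is_trig //.
  rewrite rmorph_prod (perm_big _ (permEl (perm_sort _ _))) big_map big_enum /=.
  by apply: eq_bigr => i _; rewrite rmorphB /= map_polyX map_polyC !mxE eqxx.
(* In the dual order [s] is increasing, so that the counting lemma for
   increasing sequences bounds its [k]-th entry from below. *)
rewrite charE roots_decrE //; apply: (@nth_count_le _ R^d) => //.
pose V := [set i | m <= d 0 i].
have -> : count (fun x : R^d => (x <= m)%O) s = #|V|.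
  rewrite (seq.permP (permEl (perm_sort _ _))) count_map [in RHS]cardE.
  rewrite [in RHS]/enum_mem size_filter -enumT.
  by apply: eq_count => i; rewrite /= inE.
rewrite ltnNge; apply/negP => Vk.
pose B := toC U *m invmx P.
have Bfree : row_free B.
  by rewrite /row_free mxrankMfree ?row_free_unit ?unitmx_inv // mxrank_map.
(* More than #|V| rows, restricted to #|V| columns, are dependent. *)
have [c cB c0] : exists2 c : 'rV[R[i]]_k.+1,
    c *m colsub (@enum_val _ (mem V)) B = 0 & c != 0.
  have /rowV0Pn[c /sub_kermxP cB c0] : kermx (colsub (@enum_val _ (mem V)) B) != 0.
    rewrite kermx_eq0 /row_free neq_ltn ltnS.
    by rewrite (leq_trans (rank_leq_col _)).
  by exists c.
(* [y] lists the coordinates of [x] in the eigenbasis formed by the rows of [P]. *)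
pose x := c *m toC U; pose y := x *m invmx P.
have yE : y = c *m B by rewrite /y /x -mulmxA.
have yV i : i \in V -> y 0 i = 0.
  move=> iV; have /rowP/(_ (enum_rank_in iV i)) := cB.
  rewrite yE !mxE => cB0; rewrite -[RHS]cB0; apply: eq_bigr => j _.
  by rewrite [colsub _ _ _ _]mxE enum_rankK_in.
have Pxy : P *m x^t* = y^t*.
  by rewrite -{1}[P]trmxCK -map_mxM -trmx_mul -invmx_unitary.
pose q i := complex.Re (y 0 i) ^+ 2 + complex.Im (y 0 i) ^+ 2.
have q0 i : 0 <= q i by rewrite addr_ge0 ?sqr_ge0.
have formx D : complex.Re ((x *m (invmx P *m diag_mx (toC D) *m P) *m x^t*) 0 0)
    = \sum_i D 0 i * q i.
  by rewrite -Re_sesqui_diag -Pxy !mulmxA.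
(* With all entries of [D] equal to 1 the form is the squared norm. *)
have: m * \sum_i q i <= \sum_i d 0 i * q i.
  have <- : \sum_i (const_mx 1 : 'rV[R]_N) 0 i * q i = \sum_i q i.
    by apply: eq_bigr => i _; rewrite mxE mul1r.
  rewrite -!formx -AE.
  have -> : toC (const_mx 1) = const_mx 1 :> 'rV[R[i]]_N by rewrite map_const_mx.
  rewrite diag_const_mx mulmx1 mulVmx // -(map_mx1 (real_complex R)) !Re_sesqui.
  by rewrite !mulmx1 /x map_Re_mulmx map_Im_mulmx mulrDr lerD.
have le_dq j : 0 <= m * q j - d 0 j * q j.
  have [/yV yj0|] := boolP (j \in V).
    by rewrite /q yj0 /= expr0n addr0 !mulr0 subr0.
  by rewrite inE -ltNge => dj; rewrite -mulrBl mulr_ge0 // subr_ge0 ltW.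
have /rV0Pn[i yi0] : y != 0.
  rewrite yE; apply: contra_neq c0 => cB0; apply: (row_free_inj Bfree).
  by rewrite cB0 mul0mx.
have iV : i \notin V by apply: contra yi0 => /yV ->.
apply/negP; rewrite -ltNge mulr_sumr -subr_gt0 -sumrB (bigD1 i) //=.
rewrite ltr_wpDr ?sumr_ge0 // -mulrBl mulr_gt0 //.
  by move: iV; rewrite inE -ltNge subr_gt0.
rewrite lt0r q0 andbT; apply: contra yi0; rewrite /q paddr_eq0 ?sqr_ge0 // !sqrf_eq0.
by case: (y 0 i) => u v /= /andP[/eqP-> /eqP->].
Qed.

End RealSymmetric.

(** [courant_fischer_ge] for functions on the vertices, so that the enumeration
    of the vertices which indexes the adjacency matrix can be forgotten. *)
Lemma graph_eigenvalue_ge (R : realType) (T : finType) (e : rel T) k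
    (f : 'I_k.+1 -> T -> R) (m : R) :
  symmetric e ->
  (forall c : 'rV[R]_k.+1, (forall x, \sum_i c 0 i * f i x = 0) -> c = 0) ->
  (forall (c : 'rV[R]_k.+1) (g : T -> R),
     (forall x, g x = \sum_i c 0 i * f i x) ->
     m * \sum_x g x ^+ 2 <= \sum_x g x * \sum_y (e x y)%:R * g y) ->
  m <= graph_eigenvalue R e k.+1.
Proof.
move=> e_sym f_free form_f.
pose U : 'M[R]_(k.+1, #|T|) := \matrix_(i, j) f i (enum_val j).
have cU c j : (c *m U) 0 j = \sum_i c 0 i * f i (enum_val j).
  by rewrite mxE; apply: eq_bigr => i _; rewrite mxE.
have sum_enum (F : T -> R) : \sum_(j < #|T|) F (enum_val j) = \sum_x F x.
  rewrite (reindex enum_rank) /=; last exact/onW_bij/enum_rank_bij.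
  by apply: eq_bigr => x _; rewrite enum_rankK.
apply: (@courant_fischer_ge _ _ _ _ U).
- by apply/matrixP => i j; rewrite !mxE e_sym.
- apply: inj_row_free => c cU0; apply: f_free => x.
  by rewrite -[x]enum_rankK -cU cU0 mxE.
move=> c; have := form_f c _ (fun=> erefl); rewrite -!sum_enum.
congr (_ * _ <= _).
  by rewrite mxE; apply: eq_bigr => j _; rewrite [_^T _ _]mxE cU.
rewrite -mulmxA mxE; apply: eq_bigr => j _; rewrite cU; congr (_ * _).
rewrite -sum_enum mxE; apply: eq_bigr => l _.
by rewrite [_^T _ _]mxE cU mxE.
Qed.

(** * Cliques *)

Lemma cliqueP (T : finType) (e : rel T) (S : {set T}) :
  reflect {in S &, forall x y, x != y -> e x y} (clique e S).
Proof.
apply: (iffP forall_inP) => [clS x y xS yS | clS x xS].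
  by move/forall_inP/(_ y yS)/implyP: (clS x xS).
by apply/forall_inP => y yS; apply/implyP; apply: clS.
Qed.

Lemma max_cliqueP (T : finType) (e : rel T) :
  exists2 C : {set T}, clique e C &
    #|C| = clique_number e /\ forall S, clique e S -> (#|S| <= #|C|)%N.
Proof.
have cl0 : (0 < #|[pred S : {set T} | clique e S]|)%N.
  by apply/card_gt0P; exists set0; apply/cliqueP => x; rewrite inE.
have [C clC maxC] := eq_bigmax_cond (fun S : {set T} => #|S|) cl0.
exists C => //; split=> [|S clS]; first by rewrite -maxC.
by rewrite -maxC; apply: (@leq_bigmax_cond _ _ (fun S : {set T} => #|S|) S clS).
Qed.

(** * Pineapples *)

Lemma sum_pineapple (R : zmodType) (T : finType) (C L : {set T}) v (F : T -> R) :
  v \in C -> [disjoint C & L] -> (forall x, x \notin C -> x \notin L -> F x = 0) ->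
  \sum_x F x = F v + \sum_(x in C :\ v) F x + \sum_(x in L) F x.
Proof.
move=> vC dCL F0; rewrite (bigID (mem C)) /= (bigD1 v) //=; congr (_ + _ + _).
  by apply: eq_bigl => x; rewrite !inE andbC.
rewrite (bigID (mem L)) /= addrC big1 ?add0r => [|x /andP[/F0 Fx /Fx] //].
apply: eq_bigl => x; have [xL|] := boolP (x \in L); rewrite ?andbF ?andbT //.
by rewrite (disjointFl dCL).
Qed.

(** The vertices outside the pineapple are not restricted: the test vectors
    vanish there.  On the plane they span, s u + t z with u the eigenvector of
    the pineapple for [mu] and z the indicator of C minus [v], the vector u is in
    the kernel of A - mu for the pineapple, so that the form of A - mu reduces
    to t^2 times its value (w - 1) (w - 2 - mu) at z. *)
Lemma pineapple_eigenvalue2_ge (R : realType) (T : finType) (e : rel T)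
    (C L : {set T}) (v : T) (mu : R) (w : R := #|C|%:R) (n : R := #|L|%:R) :
  symmetric e -> irreflexive e ->
  clique e C -> v \in C -> (1 < #|C|)%N -> [disjoint C & L] ->
  (forall l y, l \in L -> y \in C :|: L -> e l y = (y == v)) ->
  mu ^+ 3 - (w - 2) * mu ^+ 2 - (n + w - 1) * mu + (w - 2) * n = 0 ->
  mu != 0 -> mu < w - 2 ->
  mu <= graph_eigenvalue R e 2.
Proof.
move=> e_sym e_irr Ccl vC C_gt1 dCL eL mu_root mu0 mu_lt.
pose h (a b c : R) x := if x == v then a else if x \in C then b
                        else if x \in L then c else 0.
have hv a b c : h a b c v = a by rewrite /h eqxx.
have hC a b c x : x \in C :\ v -> h a b c x = b.
  by rewrite /h !inE => /andP[/negPf-> ->].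
have LnC x : x \in L -> x \in C = false by move/(disjointFl dCL).
have hL a b c x : x \in L -> h a b c x = c.
  move=> xL; rewrite /h xL LnC //; case: eqP => // xv.
  by move: (LnC x xL); rewrite xv vC.
have h0 a b c x : x \notin C -> x \notin L -> h a b c x = 0.
  rewrite /h => xC /negPf->; rewrite (negPf xC); case: eqP => // xv.
  by move: xC; rewrite xv vC.
have Cv : #|C :\ v|%:R = w - 1.
  by rewrite /w (cardsD1 v C) vC natrD addrAC subrr add0r.
have eC x y : x \in C -> y \in C -> e x y = (x != y).
  move=> xC yC; case: eqVneq => [->|xy]; first by rewrite e_irr.
  by move/cliqueP: Ccl; apply.
have eLC l y : l \in L -> y \in C -> e l y = (y == v).
  by move=> lL yC; rewrite eL // inE yC.
have eLL l y : l \in L -> y \in L -> e l y = false.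
  move=> lL yL; rewrite eL ?inE ?yL ?orbT //.
  by apply/eqP => yv; move: (LnC y yL); rewrite yv vC.
have sumC (F : T -> R) z : (forall x, x \in C :\ v -> F x = z) ->
    \sum_(x in C :\ v) F x = (w - 1) * z.
  by move=> Fz; rewrite (eq_bigr _ Fz) sumr_const -Cv mulr_natl.
have sumL (F : T -> R) z : (forall x, x \in L -> F x = z) ->
    \sum_(x in L) F x = n * z.
  by move=> Fz; rewrite (eq_bigr _ Fz) sumr_const -mulr_natl.
have adj_h a b c x : \sum_y (e x y)%:R * h a b c y =
    (e x v)%:R * a + (\sum_(y in C :\ v) (e x y)%:R) * b
    + (\sum_(y in L) (e x y)%:R) * c.
  rewrite (sum_pineapple _ _ _ _ _ _ vC dCL) => [|y yC yL]; last by rewrite h0 ?mulr0.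
  rewrite hv !mulr_suml; congr (_ + _ + _); apply: eq_bigr => y yS.
    by rewrite hC.
  by rewrite hL.
have norm_h a b c : \sum_x h a b c x ^+ 2 = a ^+ 2 + (w - 1) * b ^+ 2 + n * c ^+ 2.
  rewrite (sum_pineapple _ _ _ _ _ _ vC dCL) => [|y yC yL]; last by rewrite h0 ?expr0n.
  rewrite hv (sumC _ (b ^+ 2)) => [|x xC]; last by rewrite hC.
  by rewrite (sumL _ (c ^+ 2)) => [//|x xL]; rewrite hL.
have form_h a b c : \sum_x h a b c x * \sum_y (e x y)%:R * h a b c y =
    a * ((w - 1) * b + n * c) + (w - 1) * (b * (a + (w - 2) * b)) + n * (c * a).
  rewrite (sum_pineapple _ _ _ _ _ _ vC dCL) => [|y yC yL]; last by rewrite h0 ?mul0r.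
  congr (_ + _ + _).
  - rewrite hv adj_h e_irr (sumC _ 1) => [|y]; last first.
      by rewrite !inE eq_sym => /andP[yv yC]; rewrite eC // yv.
    rewrite (sumL _ 1) => [|y yL]; last by rewrite e_sym eLC ?eqxx.
    rewrite /=; ring.
  - apply: (sumC) => x xCv; rewrite hC // adj_h.
    move: (xCv); rewrite !inE => /andP[xv xC]; rewrite eC // xv.
    rewrite (bigD1 x) //= e_irr add0r.
    rewrite (eq_bigr (fun=> 1)) => [|y]; last first.
      by rewrite !inE => /andP[/andP[yv yC] yx]; rewrite eC // eq_sym yx.
    rewrite -(_ : w - 1 - 1 = \sum_(y in C :\ v | y != x) 1); last first.
      have := sumC (fun=> 1) 1 (fun _ _ => erefl); rewrite (bigD1 x) //= mulr1 => <-.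
      by rewrite addrAC subrr add0r.
    rewrite (sumL _ 0) => [|y yL]; last by rewrite e_sym eLC // (negPf xv).
    by ring.
  apply: (sumL) => x xL; rewrite hL // adj_h eLC // eqxx (sumC _ 0) => [|y]; last first.
    by rewrite !inE => /andP[yv yC]; rewrite eLC // (negPf yv).
  rewrite (sumL _ 0) => [|y yL]; last by rewrite eLL.
  rewrite /=; ring.
pose f (i : 'I_2) : T -> R :=
  if i == 0 then h (mu * (mu - (w - 2))) mu (mu - (w - 2)) else h 0 1 0.
have fE (c : 'rV[R]_2) x : \sum_i c 0 i * f i x =
    h (c 0 0 * (mu * (mu - (w - 2)))) (c 0 0 * mu + c 0 1) (c 0 0 * (mu - (w - 2))) x.
  rewrite big_ord_recl big_ord1 (_ : lift ord0 ord0 = 1); last exact: val_inj.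
  rewrite /f /= /h; case: ifP => _; first by rewrite mulr0 addr0.
  by case: ifP => _; [rewrite mulr1 | case: ifP; rewrite !mulr0 addr0].
(* Independence: the value at [v] determines the coefficient of u because
   mu (mu - (w - 2)) is nonzero, then a value on C minus [v] that of z. *)
apply: (@graph_eigenvalue_ge _ _ _ _ f) => // [c c0 | c g gE].
  have /set0Pn[u uC] : C :\ v != set0.
    by rewrite -card_gt0; move: C_gt1; rewrite (cardsD1 v C) vC.
  have := c0 v; rewrite fE hv => /eqP.
  rewrite !mulf_eq0 (negPf mu0) subr_eq0 (lt_eqF mu_lt) !orbF => /eqP c00.
  have := c0 u; rewrite fE hC // c00 mul0r add0r => c01.
  apply/rowP => -[[|[|//]] i_lt]; rewrite mxE.
    by rewrite -[RHS]c00; congr (c _ _); apply: val_inj.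
  by rewrite -[RHS]c01; congr (c _ _); apply: val_inj.
have gh := fun x => etrans (gE x) (fE c x).
under eq_bigr do rewrite gh.
under [leRHS]eq_bigr => x _.
  rewrite gh; under eq_bigr do rewrite gh.
  over.
rewrite norm_h form_h -subr_ge0.
set s := c 0 0; set t := c 0 1.
(* The coefficient of s^2 is a multiple of the cubic: u satisfies the eigenvalue
   equation identically on C minus [v] and on [L], and up to the cubic at [v]. *)
rewrite (_ : _ - _ = t ^+ 2 * ((w - 1) * (w - 2 - mu))
   - s ^+ 2 * (mu * (mu - (w - 2)))
   * (mu ^+ 3 - (w - 2) * mu ^+ 2 - (n + w - 1) * mu + (w - 2) * n)); last by ring.
rewrite mu_root mulr0 subr0 mulr_ge0 ?sqr_ge0 // mulr_ge0 //.
  by rewrite -Cv.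
by rewrite subr_ge0 ltW.
Qed.

(** The cubic is negative at - (w + n), positive at 0, negative at w - 2 and
    positive at w + n, and the intermediate value theorem gives one root in each
    of the three intervals between these points. *)
Lemma pineapple_cubic_second_root (R : realType) (w n : R) : 2 < w -> 0 < n ->
  let cubic : {poly R} :=
    'X^3 - (w - 2)%:P * 'X^2 - (n + w - 1)%:P * 'X + ((w - 2) * n)%:P in
  exists2 mu, (roots_decr cubic)`_1 = mu & [/\ root cubic mu, mu != 0 & mu < w - 2].
Proof.
move=> w_gt2 n_gt0 cubic.
have cubicE x :
    cubic.[x] = x ^+ 3 - (w - 2) * x ^+ 2 - (n + w - 1) * x + (w - 2) * n.
  by rewrite /cubic !hornerE.
have [r1 r1_in r1_root] : {r | r \in `](- (w + n)), 0[ & root cubic r}.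
  apply: poly_ivtoo; first by lra.
  rewrite nmulr_rlt0 !cubicE; first by nra.
  have : 0 <= (w - 2) * n by nra.
  by nra.
have [r2 r2_in r2_root] : {r | r \in `]0, w - 2[ & root cubic r}.
  by apply: poly_ivtoo; [lra | rewrite pmulr_rlt0 !cubicE; nra].
have [r3 r3_in r3_root] : {r | r \in `](w - 2), (w + n)[ & root cubic r}.
  apply: poly_ivtoo; first by lra.
  rewrite nmulr_rlt0 !cubicE; last by nra.
  have : 0 <= (w - 2) * n by nra.
  by nra.
move: r1_in r2_in r3_in; rewrite !in_itv /=.
move=> /andP[_ r1_lt0] /andP[r2_gt0 r2_lt] /andP[r3_gt _].
have [r21 r32 r31] : [/\ r1 < r2, r2 < r3 & r1 < r3] by split; lra.
pose tail := Poly [:: (w - 2) * n; - (n + w - 1); - (w - 2)].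
have size_tail : (size tail < size ('X^3 : {poly R}))%N.
  by rewrite size_polyXn ltnS size_Poly.
have cubic_tail : cubic = 'X^3 + tail.
  by rewrite /cubic /tail /= !cons_poly_def polyCN; ring.
have factored : cubic = \prod_(x <- [:: r3; r2; r1]) ('X - x%:P).
  rewrite {1}(@all_roots_prod_XsubC _ cubic [:: r3; r2; r1]).
  - by rewrite cubic_tail lead_coefDl // lead_coefXn scale1r.
  - by rewrite cubic_tail size_polyDl // size_polyXn.
  - by rewrite /= r1_root r2_root r3_root.
  by rewrite uniq_rootsE /= !inE !negb_or !gt_eqF.
exists r2; last by split=> //; rewrite gt_eqF.
by rewrite factored roots_decrE //= !ltW.
Qed.

(** * Power graphs of dihedral groups *)

Section DihedralPowerGraph.
Local Open Scope group_scope.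

Lemma power_graph_sym (gT : finGroupType) : symmetric (power_graph gT).
Proof. by move=> x y; rewrite /power_graph /= eq_sym orbC. Qed.

Lemma power_graph_irr (gT : finGroupType) : irreflexive (power_graph gT).
Proof. by move=> x; rewrite /power_graph /= eqxx. Qed.

Lemma power_graph1 {gT : finGroupType} (x : gT) : x != 1 -> power_graph gT 1 x.
Proof. by move=> x1; rewrite /power_graph /= eq_sym x1 group1. Qed.

(** Here <[x]> stands for the rotations and [l] for a reflection.  The powers of
    a reflection are 1 and itself, and those of a rotation are rotations, so that
    no element other than [l] has [l] among its powers. *)
Lemma involution_power_graph {gT : finGroupType} (x l y : gT) :
  (forall g, g \notin <[x]> -> g ^+ 2 = 1) -> l \notin <[x]> ->
  power_graph gT l y = (y == 1).
Proof.
move=> inv lX; have l1 : l != 1 by apply: contraNneq lX => ->; rewrite group1.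
apply/idP/eqP => [|->]; last by rewrite power_graph_sym power_graph1.
have inv_cycle g h : g \notin <[x]> -> h \in <[g]> -> h = 1 \/ h = g.
  move=> gX /cycleP[i ->]; rewrite -(expg_mod i (inv g gX)) modn2.
  by case: (odd i); [right | left].
rewrite /power_graph /= => /andP[ly /orP[ly_in | /(inv_cycle _ _ lX)[//|yl]]]; last first.
  by rewrite yl eqxx in ly.
have yX : y \notin <[x]>.
  by apply: contra lX => yX; apply: subsetP ly_in; rewrite cycle_subG.
case: (inv_cycle _ _ yX ly_in) => lE; first by rewrite lE eqxx in l1.
by rewrite lE eqxx in ly.
Qed.

(** A largest clique contains 1, which is adjacent to everything, and is at least
    as large as the triangle on 1, [x] and its inverse; a clique with an element
    [l] outside <[x]> is contained in the pair of 1 and [l]. *)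
Lemma max_clique_cycle {gT : finGroupType} (x : gT) (C : {set gT}) : (2 < #[x])%N ->
  (forall g, g \notin <[x]> -> g ^+ 2 = 1) ->
  clique (power_graph gT) C ->
  (forall S, clique (power_graph gT) S -> (#|S| <= #|C|)%N) ->
  [/\ 1 \in C, (2 < #|C|)%N & C \subset <[x]>].
Proof.
move=> ox inv /cliqueP clC maxC.
have C1 : 1 \in C.
  apply: contraT => C1; have := maxC (1 |: C); rewrite cardsU1 C1 add1n ltnn.
  apply; apply/cliqueP => y z; rewrite !inE.
  case/predU1P=> [->|yC] /predU1P[->|zC] yz; last exact: clC.
  - by rewrite eqxx in yz.
  - by apply: power_graph1; rewrite eq_sym.
  by rewrite power_graph_sym power_graph1.
have C_gt2 : (2 < #|C|)%N.
  have x1 : x != 1 by rewrite -order_gt1 ltnW.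
  have xV : x != x^-1.
    apply: contraTneq ox => xV; rewrite -leqNgt dvdn_leq // order_dvdn.
    by rewrite expgS expg1 {2}xV mulgV.
  have <- : #|[set 1; x; x^-1]| = 3%N.
    rewrite setUC cardsU1 cards2 !inE invg_eq1 (eq_sym x^-1) (eq_sym 1).
    by rewrite (negPf x1) (negPf xV).
  apply: maxC; apply/cliqueP => y z.
  rewrite !inE => /orP[/orP[]|] /eqP-> /orP[/orP[]|] /eqP-> yz;
    rewrite /power_graph /= yz;
    by rewrite ?cycleV ?groupV ?group1 ?cycle_id ?orbT.
split=> //; apply/subsetP => l lC; apply: contraLR C_gt2 => lX; rewrite -leqNgt.
have -> : 2%N = (l != 1).+1 by rewrite (contraNneq _ lX) // => ->; rewrite group1.
rewrite -cards2 subset_leq_card //; apply/subsetP => y yC; rewrite !inE.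
case: eqVneq => //= yl; rewrite -(involution_power_graph _ _ _ inv lX).
by rewrite clC // eq_sym.
Qed.

(** The properties of the rotation subgroup, extracted from the presentation with
    generators [x] and [y].  An element outside <[x]> has the form x^i y, and it
    squares to 1 because [y] inverts x^i. *)
Lemma dihedral_rotation n : (1 < n)%N ->
  exists2 x : 'D_(n.*2)%type, #[x] = n &
    #|~: <[x]>| = n /\ forall l, l \notin <[x]> -> l ^+ 2 = 1.
Proof.
move=> n_gt1; case/(isoGrpP _ (Grp_dihedral n_gt1)): (isog_refl 'D_(n.*2)).
rewrite card_dihedral // => oG.
case/existsP=> -[x y] /= /eqP[defG xn y2 xy].
have{} defG: <[x]> * <[y]> = 'D_(n.*2).
  by rewrite -norm_joinEr // norms_cycle xy groupV cycle_id.
(* Otherwise the group would be <[x]>, of order at most n. *)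
have notXy : y \notin <[x]>.
  have : (n < n.*2)%N by rewrite -addnn -{1}[n]addn0 ltn_add2l ltnW.
  apply: contraL => Xy; rewrite -leqNgt -{1}(card_dihedral n_gt1) -defG.
  by rewrite mulGSid ?cycle_subG // dvdn_leq ?(ltnW n_gt1) // order_dvdn xn.
have oy : #[y] = 2%N by apply: nt_prime_order (group1_contra notXy).
have tiXY : <[x]> :&: <[y]> = 1.
  by rewrite setIC prime_TIg ?cycle_subG // -orderE oy.
have ox : #[x] = n.
  by apply: double_inj; rewrite -muln2 -oy -TI_cardMg // defG card_dihedral.
exists x => //; split.
  have := cardsC <[x]>; rewrite -cardsT (card_dihedral n_gt1) -orderE ox => cardX.
  by apply/eqP; rewrite -(eqn_add2l n) cardX addnn.
move=> l; have : l \in 'D_(n.*2) by rewrite inE.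
rewrite -defG => /mulsgP[_ _ /cycleP[i ->] /cycleP[j ->] ->].
rewrite -(expg_mod j y2) modn2.
case: (odd j) => /=; last by rewrite mulg1 mem_cycle.
move=> _; have xyE : x ^+ i * y = y * x ^- i by rewrite conjgC conjXg xy expgVn.
rewrite expg1 expgS expg1 {2}xyE !mulgA -(mulgA (x ^+ i)).
by rewrite -(expgS y 1) y2 mulg1 mulgV.
Qed.

End DihedralPowerGraph.

Theorem theorem2p6 (R : realType) (n : nat) (hn : (3 <= n)%N) :
  let G := power_graph ('D_(n.*2))%type in
  let w : R := (clique_number G)%:R in
  let cubic : {poly R} :=
    'X^3 - (w - 2)%:P * 'X^2 - (n%:R + w - 1)%:P * 'X + ((w - 2) * n%:R)%:P in
  let mu2 : R := (roots_decr cubic)`_1 in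
  mu2 <= graph_eigenvalue R G 2.
Proof.
cbv zeta; set G := power_graph _; set w : R := (clique_number G)%:R.
have [x ox [cardL inv]] := dihedral_rotation n (ltnW hn).
have [C clC [cardC maxC]] := max_cliqueP _ G.
have [|C1 C_gt2 CX] := max_clique_cycle x C _ inv clC maxC; first by rewrite ox.
have [||mu mu2E [mu_root mu0 mu_lt]] := pineapple_cubic_second_root R w n%:R.
- by rewrite /w -cardC ltr_nat.
- by rewrite ltr0n (leq_trans _ hn).
rewrite mu2E.
apply: (@pineapple_eigenvalue2_ge _ _ _ C (~: <[x]>%g) 1%g) => //.
- exact: power_graph_sym.
- exact: power_graph_irr.
- exact: ltnW.
- by rewrite -setI_eq0 -subset0 -(setICr <[x]>%g) setSI.
- move=> l y lX _; apply: involution_power_graph inv _.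
  by rewrite inE in lX.
- by move/rootP: mu_root; rewrite !hornerE cardC cardL.
by rewrite cardC.
Qed.
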